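(* Let $U=\begin{pmatrix} A_{U} & B_{U}\\ C_{U} & D_{U}\end{pmatrix}$ and $V=\begin{pmatrix} A_{V} & B_{V}\\ C_{V} & D_{V}\end{pmatrix}$ be complex square block matrices of the same size, partitioned in the same way, with $A_U,A_V\in\mathbb{C}^{n\times n}$, $B_U,B_V\in\mathbb{C}^{n\times s}$, $C_U,C_V\in\mathbb{C}^{s\times n}$, $D_U,D_V\in\mathbb{C}^{s\times s}$, such that $A_{U}^{\#}$, $A_{V}^{\#}$, $D_{U}^{\#}$ and $D_{V}^{\#}$ exist. Suppose that $R(C_{V}^* )\subseteq R(A_{V}^* )$, $R(B_{V})\subseteq R(A_{V})$, $R(C_{V})\subseteq R(D_{V})$, $R(B_{V}^* )\subseteq R(D_{V}^* )$, $R(C_{U}^* )\subseteq R(A_{U}^* )$, $R(B_{U})\subseteq R(A_{U})$, $R(C_{U})\subseteq R(D_{U})$ and $R(B_{U}^* )\subseteq R(D_{U}^* )$. (i) If $(U,V)$ is a group inverse absorbing pair, then $(S_{U},S_{V})$ is also a group inverse absorbing pair, where $$S_{U}=\begin{pmatrix} A_{U}^\# & -A_{U}^\# B_{U}\\ C_{U}A_{U}^\# & K_{U}\end{pmatrix},\quad S_{V}=\begin{pmatrix} A_{V}^\# & -A_{V}^\# B_{V}\\ C_{V}A_{V}^\# & K_{V}\end{pmatrix},$$ with $K_{U}=D_{U}-C_{U}A_{U}^\# B_{U}$ and $K_{V}=D_{V}-C_{V}A_{V}^\# B_{V}$. (ii) If $(U,V)$ is a group inverse absorbing pair, then $(T_{U},T_{V})$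 is also a group inverse absorbing pair, where $$T_{U}=\begin{pmatrix} L_{U} & B_{U}D_{U}^\# \\ -D_{U}^\# C_{U} & D_{U}^\#\end{pmatrix},\quad T_{V}=\begin{pmatrix} L_{V} & B_{V}D_{V}^\# \\ -D_{V}^\# C_{V} & D_{V}^\#\end{pmatrix},$$ with $L_{U}=A_{U}-B_{U}D_{U}^\# C_{U}$ and $L_{V}=A_{V}-B_{V}D_{V}^\# C_{V}$.
   Context: $R(X)$ denotes the range (column space) of a matrix $X$ and $X^*$ its conjugate transpose. A square matrix $X$ is group invertible if there is a matrix $Y$ with $XYX=X$, $YXY=Y$ and $XY=YX$; such a $Y$ is unique, is called the group inverse of $X$, and is denoted $X^{\#}$. For square complex matrices $P,Q$ of the same size, the pair $(P,Q)$ is called a group inverse absorbing pair if both $P$ and $Q$ are group invertible and $P^\#+Q^\#=P^\#(P+Q)Q^\#$. $S_U$ is called the pseudo principal pivot transform of $U$ relative to $A_U$, and $T_U$ the complementary pseudo principal pivot transform of $U$ relative to $D_U$ (similarly for $V$). *)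

(* Defs.v *)
From HB Require Import structures.
From mathcomp Require Import all_boot all_order all_algebra.
From mathcomp Require Import complex.
From mathcomp Require Import boolp classical_sets reals.

Set Implicit Arguments.
Unset Strict Implicit.
Unset Printing Implicit Defensive.

Import Order.TTheory GRing.Theory Num.Theory.

Local Open Scope classical_set_scope.
Local Open Scope ring_scope.
Local Open Scope complex_scope.
Local Open Scope sesquilinear_scope.

(* The space of columns X *m v: mathcomp's own %MS order compares row spaces. *)
Definition colrange (F : fieldType) (m n : nat) (X : 'M[F]_(m, n)) :
  set 'cV[F]_m := range (fun v : 'cV[F]_n => X *m v).

Section GroupInverse.
Variables (F : fieldType) (n : nat).
Implicit Types X Y P Q : 'M[F]_n.

Definition is_group_inverse X Y : Prop :=
  [/\ X *m Y *m X = X, Y *m X *m Y = Y & X *m Y = Y *m X].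

Definition group_invertible X : Prop := exists Y, is_group_inverse X Y.

(* Total: 0 when X is not group invertible. *)
Definition group_inverse X : 'M[F]_n := xget 0 (is_group_inverse X).

Definition group_inverse_absorbing P Q : Prop :=
  [/\ group_invertible P, group_invertible Q &
      group_inverse P + group_inverse Q =
      group_inverse P *m (P + Q) *m group_inverse Q].

Lemma is_group_inverse_uniq X Y Z :
  is_group_inverse X Y -> is_group_inverse X Z -> Y = Z.
Proof.
move=> [XYX YXY cXY] [XZX ZXZ cXZ].
have e : X *m Y = X *m Z.
  by rewrite -[in LHS]XZX cXZ -!mulmxA cXY (mulmxA X) XYX.
by rewrite -YXY -cXY e cXZ -mulmxA e mulmxA ZXZ.
Qed.

Lemma group_inverseP X :
  group_invertible X -> is_group_inverse X (group_inverse X).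
Proof. exact: xgetPex. Qed.

Lemma group_inverseE X Y : is_group_inverse X Y -> group_inverse X = Y.
Proof.
by move=> XY; apply: xget_unique => // Z XZ; apply: is_group_inverse_uniq XZ XY.
Qed.

End GroupInverse.

Local Notation "X ^#" := (group_inverse X) (at level 3, format "X ^#").

Section PivotTransform.
Variables (F : fieldType) (n s : nat).
Variables (A : 'M[F]_n) (B : 'M[F]_(n, s)) (C : 'M[F]_(s, n)) (D : 'M[F]_s).

(* Pseudo principal pivot transform of block_mx A B C D relative to A. *)
Definition pseudo_ppt : 'M[F]_(n + s) :=
  block_mx A^#          (- (A^# *m B))
           (C *m A^#)   (D - C *m A^# *m B).

(* Complementary pseudo principal pivot transform, relative to D. *)
Definition compl_pseudo_ppt : 'M[F]_(n + s) :=
  block_mx (A - B *m D^# *m C)   (B *m D^#)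
           (- (D^# *m C))        D^#.

End PivotTransform.

(* Main.v *)
(* A pair (P, Q) is group inverse absorbing iff P and Q are group invertible with
   P P^# = Q Q^#, i.e. iff P and Q have the same range and the same kernel.  The
   range conditions make the blocks of U live where A and D are invertible, so
   that S_U and T_U are group inverses of each other, without any assumption on U,
   and S_U T_U = T_U S_U = diag(A A^#, D D^#).  Finally, equality of the ranges and
   of the kernels of U and V restricts to the diagonal blocks: the range of A_U is
   that of the block row (A_U B_U), and dually for kernels and block columns, and
   likewise for D. *)
Require Import Defs.
From HB Require Import structures.
From mathcomp Require Import all_boot all_order all_algebra.
From mathcomp Require Import complex.
From mathcomp Require Import boolp classical_sets reals.

Set Implicit Arguments.
Unset Strict Implicit.
Unset Printing Implicit Defensive.

Import Order.TTheory GRing.Theory Num.Theory.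

Local Open Scope classical_set_scope.
Local Open Scope ring_scope.
Local Open Scope complex_scope.
Local Open Scope sesquilinear_scope.

Local Notation "X ^#" := (group_inverse X) (at level 3, format "X ^#").

Lemma colrange_factor (F : fieldType) (m n p : nat)
    (A : 'M[F]_(m, n)) (B : 'M[F]_(m, p)) :
  colrange B `<=` colrange A -> exists Y, B = A *m Y.
Proof.
move=> BA; have colB j : exists v : 'cV[F]_n, A *m v = col j B.
  have [|v _ <-] := BA (col j B); last by exists v.
  (* Multiplying by the [j]-th unit vector extracts column [j], which therefore lies in the
     range. *)
  by exists (delta_mx j 0); rewrite // colE.
have [f Af] := choice colB; exists (\matrix_(i, j) f j i 0).
apply/matrixP => i j; have /matrixP/(_ i 0) := Af j.
by rewrite !mxE => <-; apply: eq_bigr => k _; rewrite !mxE.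
Qed.

(** Taking adjoints reverses products, so the right factor given by [colrange_factor] becomes a left
    factor. *)
Lemma adjoint_colrange_factor (K : numClosedFieldType) (m n p : nat)
    (A : 'M[K]_(n, m)) (C : 'M[K]_(p, m)) :
  colrange (C ^t*) `<=` colrange (A ^t*) -> exists Y, C = Y *m A.
Proof.
move=> /colrange_factor[Y CY]; exists (Y ^t*).
by rewrite -[C]trmxCK CY trmx_mul map_mxM trmxCK.
Qed.

Section GroupInverseTheory.
Variables (F : fieldType) (n : nat).
Implicit Types P Q X Y : 'M[F]_n.

Lemma is_group_inverse_sym X Y : is_group_inverse X Y -> is_group_inverse Y X.
Proof. by case=> XYX YXY cXY; split. Qed.

Lemma group_inverse_absorbingP P Q :
  group_inverse_absorbing P Q <->
  [/\ group_invertible P, group_invertible Q & P *m P^# = Q *m Q^#].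
Proof.
split=> [] [giP giQ e]; split=> //;
  have [_ pPp cP] := group_inverseP giP;
  have [_ qQq cQ] := group_inverseP giQ; last first.
  (* The converse comes first: equal projectors give [P^# P Q^# = Q^#] and [P^# Q Q^# = P^#]. *)
  by rewrite mulmxDr mulmxDl -cP e cQ qQq -mulmxA -e mulmxA pPp addrC.
have Ppp : P *m P^# *m P^# = P^# by rewrite cP.
have qqQ : Q^# *m (Q *m Q^#) = Q^# by rewrite mulmxA.
(* Multiplying [e] on the left by [P P^#] fixes its right side and the summand [P^#]; cancelling
   [P^#] leaves the claim. Multiplication by [Q Q^#] on the right is dual. *)
have Ppq : P *m P^# *m Q^# = Q^#.
  by move: (congr1 (mulmx (P *m P^#)) e); rewrite mulmxDr !mulmxA Ppp -e => /addrI.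
have pQq : P^# *m (Q *m Q^#) = P^#.
  have := congr1 (mulmx^~ (Q *m Q^#)) e.
  by rewrite mulmxDl -[in RHS]mulmxA qqQ -e => /addIr.
by rewrite -pQq mulmxA [in LHS]cQ mulmxA Ppq cQ.
Qed.

(* The projector X X^# is determined by the row and column spaces of X. *)
Lemma group_inverse_projector_eq X Y L M :
  group_invertible X -> group_invertible Y ->
  X = Y *m M -> Y = L *m X -> X *m X^# = Y *m Y^#.
Proof.
move=> /group_inverseP[XxX xXx cX] /group_inverseP[YyY yYy cY] XY YX.
have YyX : Y *m Y^# *m X = X by rewrite XY mulmxA YyY.
have YxX : Y *m (X^# *m X) = Y by rewrite YX -mulmxA (mulmxA X) XxX.
(* The product [Y Y^# X X^#] collapses to [X X^#] by [YyX], and to [Y Y^#] by [YxX] once both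
   projectors are commuted. *)
by rewrite -{1}YyX -mulmxA cX cY -mulmxA YxX.
Qed.

End GroupInverseTheory.

Section BlockTransforms.
Variables (F : fieldType) (n s : nat).
Variables (A : 'M[F]_n) (B : 'M[F]_(n, s)) (C : 'M[F]_(s, n)) (D : 'M[F]_s).
Hypotheses (giA : group_invertible A) (giD : group_invertible D).
Hypotheses (fB : exists Y, B = A *m Y) (fC : exists Z, C = Z *m A).
Hypotheses (fC' : exists Y, C = D *m Y) (fB' : exists Z, B = Z *m D).

Let S := pseudo_ppt A B C D.
Let T := compl_pseudo_ppt A B C D.
Let G := block_mx (A *m A^#) 0 0 (D *m D^#).

(** [A A^#] is the identity on the range of [A], which contains the columns of [B]. The next three
    facts are its analogues for rows and for [D]. *)
Let AB : A *m A^# *m B = B.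
Proof.
by have [Y ->] := fB; have [AaA _ _] := group_inverseP giA; rewrite mulmxA AaA.
Qed.

Let CA : C *m A^# *m A = C.
Proof.
have [Z ->] := fC; have [AaA _ _] := group_inverseP giA.
by rewrite -!mulmxA (mulmxA A) AaA.
Qed.

Let DC : D *m D^# *m C = C.
Proof.
by have [Y ->] := fC'; have [DdD _ _] := group_inverseP giD; rewrite mulmxA DdD.
Qed.

Let BD : B *m D^# *m D = B.
Proof.
have [Z ->] := fB'; have [DdD _ _] := group_inverseP giD.
by rewrite -!mulmxA (mulmxA D) DdD.
Qed.

Lemma mul_pseudo_ppt_compl : S *m T = G.
Proof.
have [_ _ cA] := group_inverseP giA; have [_ _ cD] := group_inverseP giD.
rewrite /S /T mulmx_block; congr block_mx.
- by rewrite mulmxBr mulmxN !mulNmx opprK !mulmxA subrK cA.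
- by rewrite mulNmx !mulmxA subrr.
(* The two terms [C A^# B D^# C] cancel, and what remains is [C - C]. *)
- by rewrite mulmxN mulmxBr mulmxBl !mulmxA CA DC opprB addrA subrK subrr.
- by rewrite mulmxBl !mulmxA addrC subrK.
Qed.

Lemma mul_compl_pseudo_ppt : T *m S = G.
Proof.
have [_ _ cA] := group_inverseP giA; have [_ _ cD] := group_inverseP giD.
rewrite /S /T mulmx_block; congr block_mx.
- by rewrite mulmxBl !mulmxA subrK.
- by rewrite mulmxN mulmxBl mulmxBr !mulmxA AB BD opprB addrA subrK subrr.
- by rewrite mulNmx !mulmxA addNr.
- by rewrite mulmxBr mulmxN mulNmx opprK !mulmxA addrC subrK cD.
Qed.

(** Both products equal [G], so [S] and [T] commute; the projectors on the diagonal of [G] fix the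
    block rows of [S] and [T]. *)
Lemma pseudo_ppt_group_inverse : is_group_inverse S T.
Proof.
have [AaA aAa cA] := group_inverseP giA; have [DdD dDd cD] := group_inverseP giD.
split; last by rewrite mul_pseudo_ppt_compl mul_compl_pseudo_ppt.
- rewrite mul_pseudo_ppt_compl /G /S mulmx_block !mul0mx !addr0 !add0r.
  by rewrite mulmxN mulmxBr !mulmxA cA aAa DC DdD.
- rewrite mul_compl_pseudo_ppt /G /T mulmx_block !mul0mx !addr0 !add0r.
  by rewrite mulmxN mulmxBr !mulmxA AaA AB cD dDd.
Qed.

End BlockTransforms.

Section Projectors.
Variables (F : fieldType) (n s : nat).
Variables (AU AV : 'M[F]_n) (BU BV : 'M[F]_(n, s)).
Variables (CU CV : 'M[F]_(s, n)) (DU DV : 'M[F]_s).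
Let U := block_mx AU BU CU DU.
Let V := block_mx AV BV CV DV.

(** The upper left block of [U = V Y] is [AV] times the block of [Y] plus a [BV] term, which [b]
    turns into a right multiple of [AV]. In [V = Z U], [c] likewise turns the [CU] term into a left
    multiple of [AU]. *)
Lemma ul_projector_eq :
    group_invertible AU -> group_invertible AV ->
    (exists Y, BV = AV *m Y) -> (exists Z, CU = Z *m AU) ->
    (exists Y, U = V *m Y) -> (exists Z, V = Z *m U) ->
  AU *m AU^# = AV *m AV^#.
Proof.
move=> giAU giAV [b BVE] [c CUE] [Y UV] [Z VU].
apply: (@group_inverse_projector_eq _ _ _ _
  (ulsubmx Z + ursubmx Z *m c) (ulsubmx Y + b *m dlsubmx Y)) => //.
- move: UV; rewrite -[Y]submxK mulmx_block !block_mxKul !block_mxKdl.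
  by case/eq_block_mx=> -> _ _ _; rewrite mulmxDr BVE mulmxA.
- move: VU; rewrite -[Z]submxK mulmx_block !block_mxKul !block_mxKur.
  by case/eq_block_mx=> -> _ _ _; rewrite mulmxDl CUE mulmxA.
Qed.

Lemma dr_projector_eq :
    group_invertible DU -> group_invertible DV ->
    (exists Y, CV = DV *m Y) -> (exists Z, BU = Z *m DU) ->
    (exists Y, U = V *m Y) -> (exists Z, V = Z *m U) ->
  DU *m DU^# = DV *m DV^#.
Proof.
move=> giDU giDV [c CVE] [b BUE] [Y UV] [Z VU].
(* The factors are read off the lower right blocks, with [CV] absorbed into [DV] and [BU] into
   [DU]. *)
apply: (@group_inverse_projector_eq _ _ _ _
  (dlsubmx Z *m b + drsubmx Z) (c *m ursubmx Y + drsubmx Y)) => //.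
- move: UV; rewrite -[Y]submxK mulmx_block !block_mxKur !block_mxKdr.
  by case/eq_block_mx=> _ _ _ ->; rewrite mulmxDr CVE mulmxA.
- move: VU; rewrite -[Z]submxK mulmx_block !block_mxKdl !block_mxKdr.
  by case/eq_block_mx=> _ _ _ ->; rewrite mulmxDl BUE mulmxA.
Qed.

End Projectors.

Section Absorbing.
Variables (F : fieldType) (n s : nat).

(** The four range inclusions in a form free of adjoints, hence meaningful over any field. *)
Definition factors_through (A : 'M[F]_n) (B : 'M[F]_(n, s)) (C : 'M[F]_(s, n))
    (D : 'M[F]_s) :=
  [/\ exists Y, B = A *m Y, exists Z, C = Z *m A,
      exists Y, C = D *m Y & exists Z, B = Z *m D].

Variables (AU AV : 'M[F]_n) (BU BV : 'M[F]_(n, s)).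
Variables (CU CV : 'M[F]_(s, n)) (DU DV : 'M[F]_s).
Hypotheses (hAU : group_invertible AU) (hAV : group_invertible AV).
Hypotheses (hDU : group_invertible DU) (hDV : group_invertible DV).
Hypotheses (fU : factors_through AU BU CU DU) (fV : factors_through AV BV CV DV).
Let U := block_mx AU BU CU DU.
Let V := block_mx AV BV CV DV.
Let S_U := pseudo_ppt AU BU CU DU.
Let S_V := pseudo_ppt AV BV CV DV.
Let T_U := compl_pseudo_ppt AU BU CU DU.
Let T_V := compl_pseudo_ppt AV BV CV DV.

(** As [T_U] and [T_V] are the group inverses of [S_U] and [S_V], this is the projector criterion
    for the transforms. *)
Lemma mul_pseudo_ppt_eq : group_inverse_absorbing U V -> S_U *m T_U = S_V *m T_V.
Proof.
move=> /group_inverse_absorbingP[giU giV UV].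
have [[fBU fCU fCU' fBU'] [fBV fCV fCV' fBV']] := (fU, fV).
have [[UuU _ cU] [VvV _ cV]] := (group_inverseP giU, group_inverseP giV).
have UVM : exists M, U = V *m M by exists (V^# *m U); rewrite mulmxA -UV UuU.
have VLU : exists L, V = L *m U.
  by exists (V *m U^#); rewrite -mulmxA -cU UV cV mulmxA VvV.
rewrite /S_U /S_V !mul_pseudo_ppt_compl //.
by rewrite (ul_projector_eq _ _ _ _ UVM VLU) // (dr_projector_eq _ _ _ _ UVM VLU).
Qed.

Lemma pseudo_ppt_absorbing :
  group_inverse_absorbing U V ->
  group_inverse_absorbing S_U S_V /\ group_inverse_absorbing T_U T_V.
Proof.
move=> /mul_pseudo_ppt_eq eST.
have [[fBU fCU fCU' fBU'] [fBV fCV fCV' fBV']] := (fU, fV).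
have ST_U : is_group_inverse S_U T_U by exact: pseudo_ppt_group_inverse.
have ST_V : is_group_inverse S_V T_V by exact: pseudo_ppt_group_inverse.
have [TS_U TS_V] := (is_group_inverse_sym ST_U, is_group_inverse_sym ST_V).
split; apply/group_inverse_absorbingP.
  split; [by exists T_U | by exists T_V |].
  by rewrite (group_inverseE ST_U) (group_inverseE ST_V).
split; [by exists S_U | by exists S_V |].
rewrite (group_inverseE TS_U) (group_inverseE TS_V).
(* Commutation turns [T S] into [S T], so the second pair has the same projectors as the first. *)
by have [[_ _ <-] [_ _ <-]] := (ST_U, ST_V).
Qed.

End Absorbing.

Theorem theorem5p6 (R : realType) (n s : nat)
  (AU AV : 'M[R[i]]_n) (BU BV : 'M[R[i]]_(n, s))
  (CU CV : 'M[R[i]]_(s, n)) (DU DV : 'M[R[i]]_s)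
  (hAU : group_invertible AU) (hAV : group_invertible AV)
  (hDU : group_invertible DU) (hDV : group_invertible DV)
  (hCAV : colrange (CV ^t*) `<=` colrange (AV ^t*))
  (hBAV : colrange BV `<=` colrange AV)
  (hCDV : colrange CV `<=` colrange DV)
  (hBDV : colrange (BV ^t*) `<=` colrange (DV ^t*))
  (hCAU : colrange (CU ^t*) `<=` colrange (AU ^t*))
  (hBAU : colrange BU `<=` colrange AU)
  (hCDU : colrange CU `<=` colrange DU)
  (hBDU : colrange (BU ^t*) `<=` colrange (DU ^t*)) :
  let U := block_mx AU BU CU DU in
  let V := block_mx AV BV CV DV in
  (group_inverse_absorbing U V ->
     group_inverse_absorbing (pseudo_ppt AU BU CU DU) (pseudo_ppt AV BV CV DV))
  /\
  (group_inverse_absorbing U V ->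
     group_inverse_absorbing (compl_pseudo_ppt AU BU CU DU)
                             (compl_pseudo_ppt AV BV CV DV)).
Proof.
have fU : factors_through AU BU CU DU.
  by split; [apply: colrange_factor | apply: adjoint_colrange_factor
            | apply: colrange_factor | apply: adjoint_colrange_factor].
have fV : factors_through AV BV CV DV.
  by split; [apply: colrange_factor | apply: adjoint_colrange_factor
            | apply: colrange_factor | apply: adjoint_colrange_factor].
move=> U V; split=> UV;
  by have [] := pseudo_ppt_absorbing hAU hAV hDU hDV fU fV UV.
Qed.
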